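(* The proof system $\mathbf{EC}^\circ$ is sound and strongly complete with respect to the class of $(c)$-frames.
   Context: Fix a nonempty set $\mathbf{P}$ of propositional variables, $p\in\mathbf{P}$. $\mathcal{L}(\bullet)$: $\varphi::=p\mid\neg\varphi\mid\varphi\land\varphi\mid\bullet\varphi$; other Boolean connectives are defined as usual and $\circ\varphi$ abbreviates $\neg\bullet\varphi$. A neighborhood frame is $\langle S,N\rangle$ with $S$ a nonempty set and $N:S\to\mathcal{P}(\mathcal{P}(S))$; a model $\mathcal{M}=\langle S,N,V\rangle$ based on it adds $V:\mathbf{P}\to\mathcal{P}(S)$. With $\varphi^{\mathcal{M}}=\{s\in S\mid\mathcal{M},s\vDash\varphi\}$: $\mathcal{M},s\vDash p$ iff $s\in V(p)$; Boolean connectives as usual; $\mathcal{M},s\vDash\bullet\varphi$ iff $s\in\varphi^{\mathcal{M}}$ and $\varphi^{\mathcal{M}}\notin N(s)$. A $(c)$-frame is one where, for all $s\in S$, $X,Y\in N(s)$ imply $X\cap Y\in N(s)$. The proof system $\mathbf{EC}^\circ$ for $\mathcal{L}(\bullet)$ has as axioms all instances of propositional tautologies and all instances of $\circ\texttt{E}$: $\bullet\varphi\to\varphi$ and $\circ\texttt{C}$: $\circ\varphi\land\circ\psi\to\circ(\varphi\land\psi)$; its rules are modus ponens and $\texttt{RE}\circ$: from $\varphi\leftrightarrow\psi$ infer $\circ\varphi\leftrightarrow\circ\psi$ (applied to theorems). Sound with respect to a class of frames: every theorem is true at every state of every model based on a frame in the class. Strongly complete: for every set $\Gamma\cup\{\varphi\}$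 of formulas, if $\varphi$ is true at every state, in every model based on a frame in the class, at which all of $\Gamma$ is true, then $\vdash\bigwedge\Gamma_0\to\varphi$ for some finite $\Gamma_0\subseteq\Gamma$ (equivalently, every consistent set is satisfiable in a model based on a frame in the class). *)

(* Defs.v *)
From Stdlib Require List.
From mathcomp Require Import all_boot.
From mathcomp Require Import classical_sets.

Set Implicit Arguments.
Unset Strict Implicit.
Unset Printing Implicit Defensive.

Local Open Scope classical_set_scope.

Inductive formula (P : Type) : Type :=
| Var of P
| Not of formula P
| And of formula P & formula P
| Bul of formula P.

Section Connectives.
Variable P : Type.
Implicit Types phi psi : formula P.

Definition Or phi psi := Not (And (Not phi) (Not psi)).
Definition Imp phi psi := Not (And phi (Not psi)).
Definition Iff phi psi := And (Imp phi psi) (Imp psi phi).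
Definition Circ phi := Not (Bul phi).

(* [formula P] has no constant, so verum is built from a variable; this is
   where nonemptiness of the set of variables is used. *)
Definition Top (p : P) := Or (Var p) (Not (Var p)).

(* The empty conjunction is [Top p]. *)
Definition bigAnd (p : P) (l : seq (formula P)) := foldr (@And P) (Top p) l.

End Connectives.

(* Schemes of classical propositional logic. The schematic letters are indexed
   by [nat] and not by [P], which may be finite: a tautology may involve any
   number of letters. *)
Inductive scheme : Type :=
| SVar of nat
| SNot of scheme
| SAnd of scheme & scheme.

Fixpoint scheme_eval (v : nat -> bool) (t : scheme) : bool :=
  match t with
  | SVar i => v i
  | SNot t1 => ~~ scheme_eval v t1
  | SAnd t1 t2 => scheme_eval v t1 && scheme_eval v t2
  end.

Definition tautology (t : scheme) : Prop := forall v, scheme_eval v t.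

Fixpoint scheme_subst (P : Type) (sigma : nat -> formula P) (t : scheme) :
    formula P :=
  match t with
  | SVar i => sigma i
  | SNot t1 => Not (scheme_subst sigma t1)
  | SAnd t1 t2 => And (scheme_subst sigma t1) (scheme_subst sigma t2)
  end.

Inductive ECcirc (P : Type) : set (formula P) :=
| ax_taut t sigma : tautology t -> ECcirc (scheme_subst sigma t)
| ax_E phi : ECcirc (Imp (Bul phi) phi)
| ax_C phi psi :
    ECcirc (Imp (And (Circ phi) (Circ psi)) (Circ (And phi psi)))
| rule_MP phi psi : ECcirc phi -> ECcirc (Imp phi psi) -> ECcirc psi
| rule_RE phi psi : ECcirc (Iff phi psi) -> ECcirc (Iff (Circ phi) (Circ psi)).

Record frame : Type := Frame {
  state :> Type;
  state_nonempty : inhabited state;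
  nbhd : state -> set (set state)
}.

Record model (P : Type) : Type := Model {
  model_frame :> frame;
  valuation : P -> set model_frame
}.

Fixpoint sat (P : Type) (M : model P) (s : M) (phi : formula P) : Prop :=
  match phi with
  | Var p => valuation p s
  | Not phi1 => ~ sat s phi1
  | And phi1 phi2 => sat s phi1 /\ sat s phi2
  | Bul phi1 => sat s phi1 /\ ~ nbhd s [set t : M | sat t phi1]
  end.

Definition c_frame (F : frame) : Prop :=
  forall (s : F) (X Y : set F), nbhd s X -> nbhd s Y -> nbhd s (X `&` Y).

Section Metatheory.
Variables (P : Type) (thm : set (formula P)) (C : frame -> Prop).

Definition sound : Prop :=
  forall phi, thm phi ->
  forall M : model P, C (model_frame M) -> forall s : M, sat s phi.

Definition consequence (Gamma : set (formula P)) (phi : formula P) : Prop :=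
  forall M : model P, C (model_frame M) ->
  forall s : M, (forall psi, Gamma psi -> sat s psi) -> sat s phi.

(* The finite subset of [Gamma] is given by a list of its elements. *)
Definition strongly_complete (p : P) : Prop :=
  forall (Gamma : set (formula P)) (phi : formula P), consequence Gamma phi ->
  exists l : seq (formula P),
    [set psi | List.In psi l] `<=` Gamma /\ thm (Imp (bigAnd p l) phi).

End Metatheory.

(* Main.v *)
Require Import Defs.
From mathcomp Require Import all_boot.
From mathcomp Require Import boolp classical_sets.

(** Strong completeness is obtained from a canonical model: the states are the
  maximal consistent sets, and [N(s)] consists of the proof sets [|phi|] with
  both [phi] and [∘phi] in [s]. The conjunct [phi \in s] makes [N(s)] closed
  under intersection by a direct use of the axiom ∘C, and the rule RE∘ makes
  membership of [|phi|] in [N(s)] independent of the choice of [phi]. *)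

Set Implicit Arguments.
Unset Strict Implicit.
Unset Printing Implicit Defensive.

Local Open Scope classical_set_scope.

(** * Soundness over (c)-frames *)

Lemma ECcirc_sound (P : Type) : sound (@ECcirc P) c_frame.
Proof.
move=> phi; elim=> {phi} [t sigma taut|phi|phi psi|phi psi _ IH1 _ IH2|
    phi psi _ IH] M cM s.
(* An instance of a scheme is evaluated by giving letter [i] the classical truth value of [sigma i]
   at [s]. *)
- have evalE u : sat s (scheme_subst sigma u) <->
      scheme_eval (fun i => `[< sat s (sigma i) >]) u.
    elim: u => [i|u IHu|u IHu v IHv] /=.
    + by split=> /asboolP.
    + by rewrite IHu; split=> /negP.
    + by rewrite IHu IHv; split=> /andP.
  exact/evalE/taut.
- by case=> -[].
(* Denying the conclusion makes [phi] and [psi] true at [s], so each premise forces the truth set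
   into [N(s)]. *)
- move=> [[sphi spsi]] /contrapT [[hphi hpsi]]; apply.
  apply: cM; apply: contrapT => nN.
  + exact: sphi.
  + exact: spsi.
- have s1 := IH1 M cM s; have s2 := IH2 M cM s.
  by apply: contrapT => npsi; apply: s2.
- have sat_iff (t : M) : sat t phi <-> sat t psi.
    have [himp hconv] := IH M cM t.
    split=> ht; apply: contrapT => nt; [exact: himp | exact: hconv].
  (* Neighborhoods see only truth sets, and these coincide by extensionality. *)
  have satE : [set t : M | sat t phi] = [set t : M | sat t psi].
    by apply/seteqP; split=> t /sat_iff.
  by split=> /=; rewrite satE sat_iff => -[] h; apply.
Qed.

(** * Derivations from hypotheses *)

Section Derivability.
Variable P : Type.
Implicit Types (phi psi chi : formula P) (Gamma Delta : set (formula P)).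

(** RE∘ acts on theorems only, so it enters through [derives_thm]; modus ponens being the only rule
    here, the deduction theorem holds. *)
Inductive derives Gamma : formula P -> Prop :=
| derives_thm phi : ECcirc phi -> derives Gamma phi
| derives_hyp phi : Gamma phi -> derives Gamma phi
| derives_mp phi psi :
    derives Gamma phi -> derives Gamma (Imp phi psi) -> derives Gamma psi.

Lemma derives_sub Gamma Delta phi :
  Gamma `<=` Delta -> derives Gamma phi -> derives Delta phi.
Proof.
move=> sub; elim=> {phi} [phi|phi /sub|phi psi _ IH1 _ IH2].
- exact: derives_thm.
- exact: derives_hyp.
- exact: derives_mp IH1 IH2.
Qed.

Lemma derives_set0 phi : derives set0 phi -> ECcirc phi.
Proof. by elim=> // {}phi psi _ IH1 _; apply: rule_MP IH1. Qed.

Let x := SVar 0.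
Let y := SVar 1.
Let z := SVar 2.
Let simp s t := SNot (SAnd s (SNot t)).
Let letters phi psi chi (i : nat) : formula P :=
  match i with 0 => phi | 1 => psi | _ => chi end.

Local Ltac taut t a b c :=
  apply: (@ax_taut _ t (letters a b c));
  let v := fresh "v" in move=> v /=;
  by case: (v 0); case: (v 1); case: (v 2).

Lemma ECcirc_K phi psi : ECcirc (Imp phi (Imp psi phi)).
Proof. taut (simp x (simp y x)) phi psi phi. Qed.

Lemma ECcirc_S phi psi chi :
  ECcirc (Imp (Imp phi (Imp psi chi)) (Imp (Imp phi psi) (Imp phi chi))).
Proof.
taut (simp (simp x (simp y z)) (simp (simp x y) (simp x z))) phi psi chi.
Qed.

Lemma ECcirc_id phi : ECcirc (Imp phi phi).
Proof. taut (simp x x) phi phi phi. Qed.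

Lemma ECcirc_andI phi psi : ECcirc (Imp phi (Imp psi (And phi psi))).
Proof. taut (simp x (simp y (SAnd x y))) phi psi phi. Qed.

Lemma ECcirc_andEl phi psi : ECcirc (Imp (And phi psi) phi).
Proof. taut (simp (SAnd x y) x) phi psi phi. Qed.

Lemma ECcirc_andEr phi psi : ECcirc (Imp (And phi psi) psi).
Proof. taut (simp (SAnd x y) y) phi psi phi. Qed.

Lemma ECcirc_uncurry phi psi chi :
  ECcirc (Imp (Imp psi (Imp phi chi)) (Imp (And phi psi) chi)).
Proof. taut (simp (simp y (simp x z)) (simp (SAnd x y) z)) phi psi chi. Qed.

Lemma ECcirc_exfalso phi psi : ECcirc (Imp phi (Imp (Not phi) psi)).
Proof. taut (simp x (simp (SNot x) y)) phi psi phi. Qed.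

Lemma ECcirc_notI phi psi :
  ECcirc (Imp (Imp phi (And psi (Not psi))) (Not phi)).
Proof. taut (simp (simp x (SAnd y (SNot y))) (SNot x)) phi psi phi. Qed.

Lemma ECcirc_notnotE phi : ECcirc (Imp (Not (Not phi)) phi).
Proof. taut (simp (SNot (SNot x)) x) phi phi phi. Qed.

Lemma derives_thm_mp Gamma phi psi :
  ECcirc (Imp phi psi) -> derives Gamma phi -> derives Gamma psi.
Proof. by move=> imp /derives_mp; apply; apply: derives_thm. Qed.

Lemma deduction Gamma phi psi :
  derives (phi |` Gamma) psi -> derives Gamma (Imp phi psi).
Proof.
elim=> {psi} [psi thm|psi [->|hyp]|psi chi _ IH1 _ IH2].
- exact/(derives_thm_mp (ECcirc_K _ _))/derives_thm.
- exact/derives_thm/ECcirc_id.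
- exact/(derives_thm_mp (ECcirc_K _ _))/derives_hyp.
- exact: derives_mp IH1 (derives_thm_mp (ECcirc_S _ _ _) IH2).
Qed.

Lemma derives_finite Gamma phi : derives Gamma phi ->
  exists2 l : seq (formula P), [set psi | List.In psi l] `<=` Gamma &
    derives [set psi | List.In psi l] phi.
Proof.
elim=> {phi} [phi thm|phi hyp|phi psi _ [l1 sub1 d1] _ [l2 sub2 d2]].
- by exists [::]; [move=> psi [] | apply: derives_thm].
- exists [:: phi]; first by move=> psi [<-|[]].
  by apply: derives_hyp; left.
- exists (l1 ++ l2).
    by move=> chi /List.in_app_iff [/sub1|/sub2].
  apply: (@derives_mp _ phi).
  + by apply: derives_sub d1 => chi h; apply/List.in_app_iff; left.
  + by apply: derives_sub d2 => chi h; apply/List.in_app_iff; right.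
Qed.

(** Hypotheses are discharged one at a time by the deduction theorem and then uncurried; [phi]
    varies in the induction because it becomes an implication. *)
Lemma derives_bigAnd p (l : seq (formula P)) phi :
  derives [set psi | List.In psi l] phi -> ECcirc (Imp (bigAnd p l) phi).
Proof.
elim: l phi => [|psi l IH] phi /= d.
  apply: rule_MP (ECcirc_K _ _); apply: derives_set0.
  by apply: derives_sub d => ? [].
apply: rule_MP (ECcirc_uncurry _ _ _); apply/IH/deduction.
by apply: derives_sub d => chi [<-|]; [left|right].
Qed.

(** A derivation uses finitely many members of the chain, and the largest of them suffices. The
    first disjunct covers the empty chain. *)
Lemma derives_chain Gamma (F : set (set (formula P))) phi :
  total_on F subset -> derives (Gamma `|` \bigcup_(X in F) X) phi ->
  derives Gamma phi \/ exists2 X, F X & derives (Gamma `|` X) phi.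
Proof.
move=> tot; elim=> {phi} [phi thm|phi [hyp|[X FX Xphi]]|
    phi psi _ IH1 _ IH2].
- by left; apply: derives_thm.
- by left; apply: derives_hyp.
- by right; exists X => //; apply: derives_hyp; right.
- have up X chi : derives Gamma chi -> derives (Gamma `|` X) chi.
    exact/derives_sub/subsetUl.
  case: IH1 => [d1|[X FX d1]]; case: IH2 => [d2|[Y FY d2]].
  + by left; apply: derives_mp d1 d2.
  + by right; exists Y => //; apply: derives_mp d2; apply: up.
  + by right; exists X => //; apply: derives_mp d1 _; apply: up.
  + right; have [sub|sub] := tot X Y FX FY.
    * exists Y => //; apply: derives_mp d2.
      exact: derives_sub (setUS sub) d1.
    * exists X => //; apply: derives_mp d1 _.
      exact: derives_sub (setUS sub) d2.
Qed.

End Derivability.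

(** * Maximal consistent sets *)

Section CanonicalModel.
Variables (P : Type) (p : P).
Implicit Types (phi psi : formula P) (Gamma s : set (formula P)).

Let bot := And (Var p) (Not (Var p)).

Definition maximal_consistent s :=
  ~ derives s bot /\ forall phi, s phi \/ s (Not phi).

Lemma derives_not Gamma phi :
  derives (phi |` Gamma) bot -> derives Gamma (Not phi).
Proof. by move/deduction; apply/derives_thm_mp/ECcirc_notI. Qed.

Lemma derives_contradiction Gamma phi psi :
  derives Gamma phi -> derives Gamma (Not phi) -> derives Gamma psi.
Proof.
by move/(derives_thm_mp (ECcirc_exfalso phi psi))/[swap]/derives_mp; apply.
Qed.

(** Zorn is applied to the sets [X] with [Gamma] united with [X] consistent, and not to the
    consistent supersets of [Gamma]: the empty chain has union [set0], which must be in the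
    family. *)
Lemma lindenbaum Gamma : ~ derives Gamma bot ->
  exists2 s, maximal_consistent s & Gamma `<=` s.
Proof.
move=> cons.
have [F Fcons tot|A [consA maxA]] :=
    @Zorn_bigcup _ [set X | ~ derives (Gamma `|` X) bot].
  by move=> /(derives_chain tot) [//|[X /Fcons]].
exists (Gamma `|` A); last exact: subsetUl.
have notin phi : ~ (Gamma `|` A) phi -> derives (Gamma `|` A) (Not phi).
  move=> nphi; apply: derives_not; rewrite setUCA; apply: contrapT.
  apply: maxA; split=> [|sub]; first exact: subsetUr.
  by apply: nphi; right; apply: sub; left.
split=> // phi; apply: contrapT => /not_orP [/notin d1 /notin d2].
exact: consA (derives_contradiction _ d1 d2).
Qed.

(** If [Not phi] were inconsistent with [Gamma], then [Gamma] would derive the double negation of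
    [phi]. *)
Lemma counterstate Gamma phi : ~ derives Gamma phi ->
  exists s, [/\ maximal_consistent s, Gamma `<=` s & s (Not phi)].
Proof.
move=> nd; have [s ms sub] : exists2 s, maximal_consistent s &
    Not phi |` Gamma `<=` s.
  by apply: lindenbaum => /derives_not /(derives_thm_mp (ECcirc_notnotE _)).
by exists s; split=> // [psi h|]; apply: sub; [right | left].
Qed.

Section MaximalConsistent.
Variables (s : set (formula P)) (ms : maximal_consistent s).

Lemma mcs_not phi : s (Not phi) <-> ~ s phi.
Proof.
split=> [nphi sphi|nphi]; last by have [/nphi|] := ms.2 phi.
by apply: ms.1; apply: derives_contradiction; apply: derives_hyp; eassumption.
Qed.

Lemma mcs_derives phi : derives s phi -> s phi.
Proof.
move=> d; apply: contrapT => /mcs_not /derives_hyp nd.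
exact: ms.1 (derives_contradiction _ d nd).
Qed.

Lemma mcs_mp phi psi : ECcirc (Imp phi psi) -> s phi -> s psi.
Proof. by move=> thm /derives_hyp /(derives_thm_mp thm) /mcs_derives. Qed.

Lemma mcs_and phi psi : s (And phi psi) <-> s phi /\ s psi.
Proof.
split=> [h|[hphi hpsi]].
  by split; apply: mcs_mp h; [apply: ECcirc_andEl | apply: ECcirc_andEr].
apply: mcs_derives; apply: derives_mp (derives_hyp hpsi) _.
exact: derives_thm_mp (ECcirc_andI _ _) (derives_hyp hphi).
Qed.

End MaximalConsistent.

(** * The canonical model *)

Definition canonical_state := {s : set (formula P) | maximal_consistent s}.

Definition proof_set phi : set canonical_state := [set s | sval s phi].

Lemma proof_setI phi psi :
  proof_set (And phi psi) = proof_set phi `&` proof_set psi.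
Proof. by apply/seteqP; split=> -[s ms] /(mcs_and ms). Qed.

(** Otherwise some maximal consistent set contains [phi] and [Not psi]. *)
Lemma proof_set_sub phi psi :
  proof_set phi `<=` proof_set psi -> ECcirc (Imp phi psi).
Proof.
move=> sub; apply: derives_set0; apply: deduction; apply: contrapT.
move=> /counterstate [s [ms hyps /(mcs_not ms)]]; apply.
by apply: (sub (exist _ s ms)); apply: hyps; left.
Qed.

Lemma circ_proof_set s phi psi : maximal_consistent s ->
  proof_set phi = proof_set psi -> s (Circ phi) -> s (Circ psi).
Proof.
move=> ms /seteqP [/proof_set_sub imp /proof_set_sub conv].
apply: (mcs_mp ms); apply: rule_MP (ECcirc_andEl _ _); apply: rule_RE.
exact: rule_MP conv (rule_MP imp (ECcirc_andI _ _)).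
Qed.

Definition canonical_nbhd (s : canonical_state) : set (set canonical_state) :=
  [set X | exists phi,
    [/\ X = proof_set phi, sval s phi & sval s (Circ phi)]].

(** Nonemptiness is a parameter, supplied once a maximal consistent set is at hand. *)
Definition canonical_frame (ne : inhabited canonical_state) : frame :=
  Frame ne canonical_nbhd.

Lemma canonical_c_frame ne : c_frame (canonical_frame ne).
Proof.
move=> [s ms] _ _ [phi [-> sphi cphi]] [psi [-> spsi cpsi]].
exists (And phi psi); split; first by rewrite proof_setI.
  exact/(mcs_and ms).
by apply: (mcs_mp ms (ax_C _ _)); apply/(mcs_and ms).
Qed.

Definition canonical_model ne : model P :=
  @Model P (canonical_frame ne) (fun q => proof_set (Var q)).

Lemma truth_lemma ne phi (s : canonical_model ne) :
  sat s phi <-> sval s phi.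
Proof.
elim: phi s => [q|phi IH|phi IH1 psi IH2|phi IH] [s ms] //=.
- by rewrite IH; symmetry; apply: mcs_not.
- by rewrite IH1 IH2; symmetry; apply: mcs_and.
have -> : [set t : canonical_model ne | sat t phi] = proof_set phi.
  by apply/seteqP; split=> t /IH.
rewrite IH /=; split=> [[sphi nN]|sbul].
  (* If [Bul phi] is not in [s], then [Circ phi] is, and with [phi] in [s] it makes the proof set a
     neighborhood. *)
  apply: contrapT => /(mcs_not ms) circ; apply: nN.
  by exists phi.
split; first exact: mcs_mp (ax_E _) sbul.
(* The witness [psi] of the neighborhood may differ from [phi]; equality of proof sets carries
   [Circ psi] over to [Circ phi]. *)
move=> [psi [eq_sets _ /(circ_proof_set ms (esym eq_sets))]].
by move/(mcs_not ms).
Qed.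

End CanonicalModel.

(** * Strong completeness *)

Lemma ECcirc_strongly_complete (P : Type) (p : P) :
  strongly_complete (@ECcirc P) c_frame p.
Proof.
move=> Gamma phi cons.
suff /derives_finite [l sub d] : derives Gamma phi.
  by exists l; split=> //; apply: derives_bigAnd.
(* An underivable [phi] fails at a canonical state containing [Gamma]; that state also shows the
   frame nonempty. *)
apply: contrapT => /(counterstate p) [s [ms sub /(mcs_not ms)]]; apply.
pose w : canonical_state p := exist _ s ms.
have ne : inhabited (canonical_state p) by [].
apply/(truth_lemma phi (w : canonical_model ne))/cons.
  exact: canonical_c_frame.
by move=> psi /sub spsi; apply/truth_lemma.
Qed.

Theorem theorem5p7 (P : Type) (p : P) :
  sound (@ECcirc P) c_frame /\ strongly_complete (@ECcirc P) c_frame p.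
Proof.
split; first exact: ECcirc_sound.
exact: ECcirc_strongly_complete.
Qed.
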